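(* Let $n\ge 1$ be an integer, let $u_0,u_1,\dots,u_n$ be a sequence of (compact, nonempty) real intervals with $u_0=[0,0]$, and let $\lambda_1,\lambda_2\ge 1$ be such that the interval powers $u_i^{\lambda_1}$ and $(\nabla u_i)^{\lambda_2}$ are defined for $1\le i\le n$. If the sequence $(u_i)$ is monotone and $\mu$-increasing, then $$\sum_{i=1}^{n}\Big\|u_i^{\lambda_1}\cdot(\nabla u_i)^{\lambda_2}\Big\|\le \frac{\lambda_2(n+1)^{\lambda_1}}{\lambda_1+\lambda_2}\sum_{i=1}^{n}\|\nabla u_i\|^{\lambda_1+\lambda_2}.$$
   Context: An interval is $u=[\underline{u},\overline{u}]=\{t\in\mathbb{R}:\underline{u}\le t\le\overline{u}\}$ with $\underline u\le\overline u$ real; $len(u)=\overline u-\underline u$. Product: $u\cdot v=[\min S,\max S]$ with $S=\{\underline u\,\underline v,\ \underline u\,\overline v,\ \overline u\,\underline v,\ \overline u\,\overline v\}$. gH-difference: $u\ominus_g v=[\min\{\underline u-\underline v,\overline u-\overline v\},\max\{\underline u-\underline v,\overline u-\overline v\}]$. Backward gH-difference operator: $\nabla u_i=u_i\ominus_g u_{i-1}$. Quasi-norm: $\|u\|=\max\{|\underline u|,|\overline u|\}$. Power: $u^{\lambda}=\{t^{\lambda}:t\in u\}$, considered when $t^\lambda$ is defined for all $t\in u$: $\lambda\ge1$ may be any real number if $u\subseteq[0,\infty)$, while $\lambda$ is a positive integer if $u$ contains negative numbers. A sequence $(u_i)$ of intervals is increasing (decreasing) if both real sequences $(\underline{u_i})$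 and $(\overline{u_i})$ are increasing (decreasing), in the weak sense; it is monotone if it is increasing or decreasing. It is $\mu$-increasing if the real sequence $(len(u_i))$ is increasing (weakly). *)

(* Defs.v *)
From mathcomp Require Import all_boot all_order all_algebra archimedean.
From mathcomp Require Import all_classical all_reals all_analysis.

Set Implicit Arguments.
Unset Strict Implicit.
Unset Printing Implicit Defensive.

Import Order.TTheory GRing.Theory Num.Theory.

Local Open Scope classical_set_scope.
Local Open Scope ring_scope.

Section IntervalArithmetic.
Context {R : realType}.
Implicit Types (u v : set R) (U : nat -> set R) (a : nat -> R) (l t : R).

Definition is_citv u : Prop := exists a b : R, a <= b /\ u = `[a, b]%classic.

(* The endpoints of an interval; only meaningful under [is_citv] (see
   [lo_itv] and [hi_itv]). *)
Definition lo u : R := inf u.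
Definition hi u : R := sup u.

Definition len u : R := hi u - lo u.

Definition imul u v : set R :=
  `[Num.min (Num.min (lo u * lo v) (lo u * hi v))
            (Num.min (hi u * lo v) (hi u * hi v)),
    Num.max (Num.max (lo u * lo v) (lo u * hi v))
            (Num.max (hi u * lo v) (hi u * hi v))]%classic.

Definition gHsub u v : set R :=
  `[Num.min (lo u - lo v) (hi u - hi v), Num.max (lo u - lo v) (hi u - hi v)]%classic.

(* Junk value at i = 0. *)
Definition nabla U (i : nat) : set R := gHsub (U i) (U i.-1).

Definition inorm u : R := Num.max `|lo u| `|hi u|.

(* The library's [powR] is the usual real power on nonnegative bases only
   (it is 1 at a negative base), hence the separate case of a natural number
   exponent. The two cases agree when both apply, see [rpow_powR]. *)
Definition rpow t l : R :=
  if l \is a Num.nat then t ^+ Num.truncn l else t `^ l.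

Definition ipow u l : set R := [set rpow t l | t in u].

Definition ipow_defined u l : Prop :=
  1 <= l /\ ((exists2 t, u t & t < 0) -> l \is a Num.nat).

Definition increasing_upto (n : nat) a : Prop :=
  forall i j : nat, (i <= j <= n)%N -> a i <= a j.

Definition decreasing_upto (n : nat) a : Prop :=
  forall i j : nat, (i <= j <= n)%N -> a j <= a i.

Definition iincreasing_upto (n : nat) U : Prop :=
  increasing_upto n (fun i => lo (U i)) /\
  increasing_upto n (fun i => hi (U i)).

Definition idecreasing_upto (n : nat) U : Prop :=
  decreasing_upto n (fun i => lo (U i)) /\
  decreasing_upto n (fun i => hi (U i)).

Definition imonotone_upto (n : nat) U : Prop :=
  iincreasing_upto n U \/ idecreasing_upto n U.

Definition mu_increasing_upto (n : nat) U : Prop :=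
  increasing_upto n (fun i => len (U i)).

Lemma lo_itv (x y : R) : x <= y -> lo `[x, y]%classic = x.
Proof. exact: inf_itvcc. Qed.

Lemma hi_itv (x y : R) : x <= y -> hi `[x, y]%classic = y.
Proof. exact: sup_itvcc. Qed.

Lemma rpow_powR t l : 0 <= t -> rpow t l = t `^ l.
Proof.
move=> t0; rewrite /rpow; case: ifPn => // ln.
by rewrite -powR_mulrn// truncnK.
Qed.

Lemma rpow_natr t (n : nat) : rpow t n%:R = t ^+ n.
Proof. by rewrite /rpow natr_nat natrK. Qed.

End IntervalArithmetic.

(* Main.v *)
Require Import Defs.
From mathcomp Require Import all_boot all_order all_algebra.
From mathcomp Require Import all_classical all_reals all_analysis.
From mathcomp Require Import ring lra.

Import Order.TTheory GRing.Theory Num.Theory.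

Local Open Scope classical_set_scope.
Local Open Scope ring_scope.

(** An Opial inequality for intervals reduces to one for real numbers, because
the quasi-norm behaves like an absolute value. It is submultiplicative, the
norm of a power is at most the power of the norm, and the gH-difference
controls the variation of both endpoints. Hence, with
[x j] the norm of the [j]-th backward difference, telescoping from
the interval [[0, 0]] gives [inorm (u i) <= x 1 + ... + x i], and everything
follows from the discrete Opial inequality for nonnegative reals
([discrete_opial]):
  [\sum_(i <= n) (x 1 + ... + x i) `^ p * x i `^ q
     <= q * (n + 1) `^ p / (p + q) * \sum_(i <= n) x i `^ (p + q)].

That inequality is proved by induction on [n]. Write [T n] for
[\sum_(i <= n) x i `^ (p + q)]. The power mean inequality
([powR_sum_le]) splits [(x 1 + ... + x n) `^ p] into
[n `^ (p - 1) * \sum_(j <= n) x j `^ p], and the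
weighted arithmetic-geometric mean inequality ([weighted_young]) bounds each
[x j `^ p * x n `^ q] by a combination of [x j `^ (p + q)] and
[x n `^ (p + q)]. Together they bound [p + q] times the [n]-th term by
[p * n `^ (p - 1) * T n + q * n `^ p * x n `^ (p + q)]. Since
[p * n `^ (p - 1) <= (n + 1) `^ p - n `^ p] and [1 <= q], this is at most the
increment [q * (n + 1) `^ p * T n - q * n `^ p * T (n - 1)] of the bound, so
the sum telescopes. The power mean inequality and the last
estimate both come from the convexity of the power function, in the form of
its tangent line inequality ([powR_tangent_le]). *)

(** * Inequalities for real powers *)

(** Young's inequality for [x `^ p] and [y `^ q] with the conjugate exponents
[(p + q) / p] and [(p + q) / q]. *)
Lemma weighted_young (R : realType) (p q x y : R) :
  0 <= p -> 0 < q -> 0 <= x -> 0 <= y ->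
  (p + q) * (x `^ p * y `^ q) <= p * x `^ (p + q) + q * y `^ (p + q).
Proof.
rewrite le_eqVlt => /predU1P[<-|p0] q0 x0 y0.
  by rewrite !add0r powRr0 mul1r mul0r add0r.
have pq0 : 0 < p + q by rewrite addr_gt0.
have p_neq0 : p != 0 by rewrite gt_eqF.
have q_neq0 : q != 0 by rewrite gt_eqF.
have pq_neq0 : p + q != 0 by rewrite gt_eqF.
have := @conjugate_powR R (x `^ p) (y `^ q) ((p + q) / p) ((p + q) / q)
  (powR_ge0 _ _) (powR_ge0 _ _) (divr_gt0 pq0 p0) (divr_gt0 pq0 q0).
rewrite -!powRrM !(mulrC _ ((p + q) / _)) !divfK// !invf_div -mulrDl divff//.
move=> /(_ erefl) /(ler_wpM2l (ltW pq0)) /le_trans; apply.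
rewrite le_eqVlt; apply/orP; left; apply/eqP.
by field.
Qed.

(** The convex function [powR ^~ p] lies above its tangent line at [s]. *)
Lemma powR_tangent_le (R : realType) (p s t : R) :
  1 <= p -> 0 <= s -> 0 <= t ->
  p * s `^ (p - 1) * t <= (p - 1) * s `^ p + t `^ p.
Proof.
move=> p1 s0 t0; have p10 : 0 <= p - 1 by rewrite subr_ge0.
have := @weighted_young R (p - 1) 1 s t p10 ltr01 s0 t0.
by rewrite subrK powRr1// mul1r mulrA.
Qed.

(** Power mean inequality: sum the tangent line inequalities at the mean [s],
where the slope terms add up to [p * s `^ p] per summand. *)
Lemma powR_sum_le (R : realType) (p : R) (n : nat) (x : nat -> R) :
  1 <= p -> (forall j, 0 <= x j) ->
  (\sum_(j < n.+1) x j) `^ p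
    <= n.+1%:R `^ (p - 1) * \sum_(j < n.+1) x j `^ p.
Proof.
move=> p1 x0; have p_gt0 : 0 < p by rewrite (lt_le_trans ltr01).
set S := \sum_(j < n.+1) x j; set N : R := n.+1%:R; pose s := S / N.
have N0 : 0 < N by rewrite ltr0n.
have S0 : 0 <= S by apply: sumr_ge0.
have s0 : 0 <= s by rewrite divr_ge0// ltW.
have SE : S = N * s by rewrite /s mulrC divfK// gt_eqF.
have : \sum_(j < n.+1) p * s `^ (p - 1) * x j
    <= \sum_(j < n.+1) ((p - 1) * s `^ p + x j `^ p).
  by apply: ler_sum => j _; exact: powR_tangent_le.
rewrite -mulr_sumr -/S big_split/= sumr_const card_ord -mulr_natl -/N SE.
rewrite -(mulr_powRB1 s0 p_gt0) => sum_tangent.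
rewrite powRM ?(ltW N0)// -(mulr_powRB1 (ltW N0) p_gt0).
rewrite -mulrA mulrCA ler_wpM2l ?powR_ge0// -(mulr_powRB1 s0 p_gt0).
by lra.
Qed.

(** The tangent line at [N], evaluated at [N + 1]. *)
Lemma powR_increment_ge (R : realType) (p N : R) : 1 <= p -> 0 <= N ->
  p * N `^ (p - 1) <= (N + 1) `^ p - N `^ p.
Proof.
move=> p1 N0; have p_gt0 : 0 < p by rewrite (lt_le_trans ltr01).
have := @powR_tangent_le R p N (N + 1) p1 N0 (addr_ge0 N0 ler01).
by rewrite -(mulr_powRB1 N0 p_gt0); lra.
Qed.

(** * The discrete Opial inequality *)

(** The right-hand side is the increment of the bound of [discrete_opial],
multiplied by [p + q], so that the bound follows by telescoping. In the proof
every [j <= n] is treated by [weighted_young], including the diagonal [j = n],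
where it is an equality. *)
Lemma discrete_opial_step (R : realType) (p q : R) (n : nat) (x : nat -> R) :
  1 <= p -> 1 <= q -> (forall j, 0 <= x j) ->
  (p + q) * ((\sum_(j < n.+1) x j) `^ p * x n `^ q)
    <= q * n.+2%:R `^ p * \sum_(j < n.+1) x j `^ (p + q)
       - q * n.+1%:R `^ p * \sum_(j < n) x j `^ (p + q).
Proof.
move=> p1 q1 x0.
have p_gt0 : 0 < p by rewrite (lt_le_trans ltr01).
have q_gt0 : 0 < q by rewrite (lt_le_trans ltr01).
have pq0 : 0 <= p + q by rewrite addr_ge0// ltW.
have N0 : 0 <= n.+1%:R :> R by rewrite ler0n.
apply: (@le_trans _ _ (n.+1%:R `^ (p - 1) *
    \sum_(j < n.+1) ((p + q) * (x j `^ p * x n `^ q)))).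
  rewrite -mulr_sumr -mulr_suml [leRHS]mulrCA ler_wpM2l// mulrA.
  by rewrite ler_wpM2r ?powR_ge0//; exact: powR_sum_le.
apply: (@le_trans _ _ (n.+1%:R `^ (p - 1) *
    \sum_(j < n.+1) (p * x j `^ (p + q) + q * x n `^ (p + q)))).
  rewrite ler_wpM2l ?powR_ge0//; apply: ler_sum => j _.
  by rewrite weighted_young// ltW.
rewrite big_split/= -mulr_sumr sumr_const card_ord -[(q * _) *+ _]mulr_natl.
set T := \sum_(j < n.+1) _.
have -> : \sum_(j < n) x j `^ (p + q) = T - x n `^ (p + q).
  by rewrite /T big_ord_recr/= addrK.
have T0 : 0 <= T by apply: sumr_ge0 => j _; exact: powR_ge0.
have := @powR_increment_ge R p n.+1%:R p1 N0; rewrite natr1.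
rewrite -(mulr_powRB1 N0 p_gt0).
set A := n.+2%:R `^ p; set N := n.+1%:R; set B := N `^ (p - 1).
move=> incr; have incr0 : 0 <= A - N * B.
  by rewrite (le_trans _ incr)// mulr_ge0 ?powR_ge0// ltW.
have : p * B <= q * (A - N * B).
  by rewrite (le_trans incr)// ler_peMl.
move=> /(ler_wpM2r T0).
by lra.
Qed.

Lemma discrete_opial (R : realType) (p q : R) (n : nat) (x : nat -> R) :
  1 <= p -> 1 <= q -> (forall j, 0 <= x j) ->
  \sum_(i < n) (\sum_(j < i.+1) x j) `^ p * x i `^ q
    <= q * n.+1%:R `^ p / (p + q) * \sum_(i < n) x i `^ (p + q).
Proof.
move=> p1 q1 x0.
have pq0 : 0 < p + q by rewrite addr_gt0// (lt_le_trans ltr01).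
rewrite mulrAC ler_pdivlMr// mulrC.
elim: n => [|n IHn]; first by rewrite !big_ord0 !mulr0.
rewrite big_ord_recr/= mulrDr.
have := @discrete_opial_step R p q n x p1 q1 x0.
by move: IHn; lra.
Qed.

(** * The quasi-norm *)

Section QuasiNorm.
Context {R : realType}.
Implicit Types (u v : set R) (l t M : R).

Lemma inorm_ge0 u : 0 <= inorm u.
Proof. by rewrite le_max normr_ge0. Qed.

Lemma inorm_le u M : u !=set0 -> (forall t, u t -> `|t| <= M) -> inorm u <= M.
Proof.
move=> u_n0 uM.
have uM' t : u t -> - M <= t <= M by move=> /uM; rewrite ler_norml.
have [t0 ut0] := u_n0.
have lbM : lbound u (- M) by move=> t /uM'/andP[].
have ubM : ubound u M by move=> t /uM'/andP[].
have loM : - M <= lo u by exact: lb_le_inf.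
have hiM : hi u <= M by exact: ge_sup.
have lot : lo u <= t0 by apply: ge_inf => //; exists (- M).
have hit : t0 <= hi u by apply: ub_le_sup => //; exists M.
have /andP[t0_ge t0_le] := uM' _ ut0.
by rewrite ge_max !ler_norml; apply/andP; split; apply/andP; split; lra.
Qed.

Lemma inorm_itv (a b : R) : a <= b ->
  inorm `[a, b]%classic = Num.max `|a| `|b|.
Proof. by move=> ab; rewrite /inorm lo_itv// hi_itv. Qed.

Lemma norm_le_inorm u t : is_citv u -> u t -> `|t| <= inorm u.
Proof.
move=> [a [b [ab ->]]] /=; rewrite in_itv/= => /andP[a_t t_b].
rewrite inorm_itv// le_max; apply/orP; have [t0|t0] := leP 0 t; [right|left].
  by rewrite (ger0_norm t0) (le_trans t_b)// ler_norm.
by rewrite (ltr0_norm t0) -(normrN a) (le_trans _ (ler_norm _))// lerN2.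
Qed.

Lemma norm_lo_le u : `|lo u| <= inorm u. Proof. by rewrite le_max lexx. Qed.

Lemma norm_hi_le u : `|hi u| <= inorm u.
Proof. by rewrite le_max lexx orbT. Qed.

(** The endpoints of a product are among the four products of endpoints. *)
Lemma inorm_imul_le u v : inorm (imul u v) <= inorm u * inorm v.
Proof.
have corner a b : `|a| <= inorm u -> `|b| <= inorm v ->
    `|a * b| <= inorm u * inorm v.
  by move=> ua vb; rewrite normrM ler_pM.
have norm_min a b M : `|a| <= M -> `|b| <= M -> `|Num.min a b| <= M.
  by move=> aM bM; rewrite /Order.min; case: ifP.
have norm_max a b M : `|a| <= M -> `|b| <= M -> `|Num.max a b| <= M.
  by move=> aM bM; rewrite /Order.max; case: ifP.
rewrite inorm_itv; last by rewrite !ge_min !le_max !lexx.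
by rewrite ge_max; apply/andP; split;
  [do 2!apply: (norm_min) | do 2!apply: (norm_max)];
  apply: corner; rewrite ?norm_lo_le ?norm_hi_le.
Qed.

Lemma gHsub_citv u v : is_citv (gHsub u v).
Proof.
by do 2!eexists; split; last reflexivity; rewrite ge_min !le_max lexx.
Qed.

(** Whichever of the two endpoint differences is the smaller, both are
endpoints of the gH-difference. *)
Lemma inorm_gHsub u v :
  inorm (gHsub u v) = Num.max `|lo u - lo v| `|hi u - hi v|.
Proof.
rewrite inorm_itv; last by rewrite ge_min !le_max lexx.
by case: (leP (lo u - lo v)) => // _; rewrite maxC.
Qed.

Lemma inorm_le_gHsub u v : inorm u <= inorm v + inorm (gHsub u v).
Proof.
rewrite inorm_gHsub ge_max; apply/andP; split.
  rewrite -{1}(subrKC (lo v) (lo u)) (le_trans (ler_normD _ _))//.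
  by rewrite lerD ?norm_lo_le// le_max lexx.
rewrite -{1}(subrKC (hi v) (hi u)) (le_trans (ler_normD _ _))//.
by rewrite lerD ?norm_hi_le// le_max lexx orbT.
Qed.

Lemma norm_rpow t l : (t < 0 -> l \is a Num.nat) -> `|rpow t l| = `|t| `^ l.
Proof.
have [t0 _|t0 /(_ isT) l_nat] := leP 0 t.
  by rewrite rpow_powR// !ger0_norm ?powR_ge0.
by rewrite /rpow l_nat normrX -powR_mulrn ?truncnK.
Qed.

Lemma inorm_ipow_le u l : is_citv u -> ipow_defined u l ->
  inorm (ipow u l) <= inorm u `^ l.
Proof.
move=> u_itv [l1 l_nat]; apply: inorm_le.
  have [a [b [ab ->]]] := u_itv.
  by exists (rpow a l), a => //=; rewrite in_itv/= lexx.
move=> _ [t ut <-].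
rewrite norm_rpow; last by move=> t0; apply: l_nat; exists t.
rewrite ge0_ler_powR ?nnegrE ?inorm_ge0 ?norm_le_inorm//.
by rewrite (le_trans ler01).
Qed.

(** Telescoping of [inorm_le_gHsub]; the differences are indexed from [0], so
that [j.+1] stands for their usual index. *)
Lemma inorm_le_sum_nabla (U : nat -> set R) (i : nat) :
  U 0%N = `[0, 0]%classic ->
  inorm (U i) <= \sum_(j < i) inorm (nabla U j.+1).
Proof.
move=> U0; elim: i => [|i IHi].
  by rewrite big_ord0 U0 inorm_itv// normr0 maxxx.
by rewrite big_ord_recr/= (le_trans (inorm_le_gHsub _ (U i)))// lerD2r.
Qed.

End QuasiNorm.

Theorem theorem3p5 (R : realType) (n : nat) (u : nat -> set R) (l1 l2 : R)
    (n_ge1 : (1 <= n)%N)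
    (u_itv : forall i : nat, (i <= n)%N -> is_citv (u i))
    (u0 : u 0%N = `[0, 0]%classic)
    (l1_ge1 : 1 <= l1) (l2_ge1 : 1 <= l2)
    (pow1 : forall i : nat, (1 <= i <= n)%N -> ipow_defined (u i) l1)
    (pow2 : forall i : nat, (1 <= i <= n)%N -> ipow_defined (nabla u i) l2)
    (u_mono : imonotone_upto n u)
    (u_mu : mu_increasing_upto n u) :
  \sum_(1 <= i < n.+1) inorm (imul (ipow (u i) l1) (ipow (nabla u i) l2))
  <= l2 * n.+1%:R `^ l1 / (l1 + l2)
     * \sum_(1 <= i < n.+1) inorm (nabla u i) `^ (l1 + l2).
Proof.
rewrite !big_add1 !big_mkord.
apply: (le_trans _ (@discrete_opial R l1 l2 n (fun j => inorm (nabla u j.+1))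
  l1_ge1 l2_ge1 (fun=> inorm_ge0 _))).
have l1_ge0 : 0 <= l1 by rewrite (le_trans ler01).
apply: ler_sum => i _.
have i_le_n : (1 <= i.+1 <= n)%N by rewrite ltn_ord.
apply: (le_trans (inorm_imul_le _ _)).
rewrite ler_pM ?inorm_ge0//; last first.
  exact: inorm_ipow_le (gHsub_citv _ _) (pow2 _ i_le_n).
apply: (le_trans (inorm_ipow_le _ _ (u_itv _ (ltn_ord i)) (pow1 _ i_le_n))).
rewrite ge0_ler_powR ?nnegrE ?inorm_ge0 ?inorm_le_sum_nabla//.
by apply: sumr_ge0 => j _; exact: inorm_ge0.
Qed.
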